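(* Let $\lambda\ge 0$ and let $Z$ be the complex-valued Ornstein-Uhlenbeck process with parameter $\lambda$ started from $z_0=1+i0$, with radial process $R^Z_t=|Z_t|$. Then $$\frac{\log R^{Z}_{t}}{t}\ \longrightarrow\ 0\qquad\text{in law, as } t\to\infty.$$
   Context: The complex-valued Ornstein-Uhlenbeck (OU) process $Z$ with parameter $\lambda\ge 0$ started from $z_0$ is the solution of $Z_t=z_0+W_t-\lambda\int_0^t Z_s\,ds$, where $(W_t,t\ge 0)$ is a planar (complex-valued) Brownian motion with $W_0=0$. Throughout, $z_0=1+i0$. The process $Z$ a.s. never visits $0$. *)

(* Defs.v *)
From HB Require Import structures.
From mathcomp Require Import all_boot all_order all_algebra.
From mathcomp Require Import all_classical all_reals all_analysis.
From mathcomp.real_closed Require Import complex.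

Set Implicit Arguments.
Unset Strict Implicit.
Unset Printing Implicit Defensive.

Import Order.TTheory GRing.Theory Num.Theory.
Import numFieldNormedType.Exports.

Local Open Scope classical_set_scope.
Local Open Scope ring_scope.
Local Open Scope complex_scope.

Section Processes.
Context {d : measure_display} {T : measurableType d} {R : realType}.
Variable P : probability T R.

(* Processes are indexed by R; only the times t >= 0 are constrained. *)

(* Product rule over the whole family: the rule over a subfamily is the case
   A i = setT for the other indices. *)
Definition mutually_independent (n : nat) (X : 'I_n -> T -> R) : Prop :=
  forall A : 'I_n -> set R, (forall i, measurable (A i)) ->
    P (\bigcap_(i in [set: 'I_n]) (X i @^-1` A i)) =
    (\prod_(i < n) P (X i @^-1` A i))%E.

Definition process_sigma_algebra (X : R -> T -> R) : set (set T) :=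
  <<s \bigcup_(t in [set t : R | 0 <= t])
        preimage_set_system setT (X t) measurable >>.

Definition independent_processes (X Y : R -> T -> R) : Prop :=
  forall A B, process_sigma_algebra X A -> process_sigma_algebra Y B ->
    P (A `&` B) = (P A * P B)%E.

Definition continuous_path (x : R -> R) : Prop :=
  {within `[0, +oo[, continuous x}.

(* The second argument of [normal_prob] is the standard deviation. *)
Record standard_brownian_motion (B : R -> T -> R) : Prop := {
  sbm_measurable : forall t, 0 <= t -> measurable_fun setT (B t) ;
  sbm_start : {ae P, forall w, B 0 w = 0} ;
  sbm_independent_increments : forall (n : nat) (t : nat -> R),
    0 <= t 0%N -> {homo t : i j / (i <= j)%N >-> i <= j} ->
    mutually_independent (fun (i : 'I_n) w => B (t i.+1) w - B (t i) w) ;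
  sbm_normal_increments : forall s t, 0 <= s -> s < t ->
    forall A : set R, measurable A ->
      P ((fun w => B t w - B s w) @^-1` A) =
      normal_prob 0 (Num.sqrt (t - s)) A ;
  sbm_continuous : {ae P, forall w, continuous_path (B ^~ w)} }.

Definition re_process (Z : R -> T -> R[i]) (t : R) (w : T) : R :=
  complex.Re (Z t w).
Definition im_process (Z : R -> T -> R[i]) (t : R) (w : T) : R :=
  complex.Im (Z t w).

Record planar_brownian_motion (W : R -> T -> R[i]) : Prop := {
  pbm_re : standard_brownian_motion (re_process W) ;
  pbm_im : standard_brownian_motion (im_process W) ;
  pbm_independent : independent_processes (re_process W) (im_process W) }.

Definition complex_integral (f : R -> R[i]) (a b : R) : R[i] :=
  (\int[lebesgue_measure]_(s in `[a, b]) complex.Re (f s)) +i*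
  (\int[lebesgue_measure]_(s in `[a, b]) complex.Im (f s)).

(* The noise is additive, so the stochastic equation is a pathwise integral
   equation; continuity of the paths makes the integral well defined. *)
Record ornstein_uhlenbeck (lambda : R) (z0 : R[i]) (W Z : R -> T -> R[i]) :
    Prop := {
  ou_measurable_re : forall t, 0 <= t -> measurable_fun setT (re_process Z t) ;
  ou_measurable_im : forall t, 0 <= t -> measurable_fun setT (im_process Z t) ;
  ou_continuous_re : {ae P, forall w, continuous_path (re_process Z ^~ w)} ;
  ou_continuous_im : {ae P, forall w, continuous_path (im_process Z ^~ w)} ;
  ou_equation : {ae P, forall w, forall t, 0 <= t ->
    Z t w = z0 + W t w - lambda%:C * complex_integral (Z ^~ w) 0 t} }.

Definition radial_process (Z : R -> T -> R[i]) (t : R) (w : T) : R :=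
  ComplexField.Normc.normc (Z t w).

Definition converges_in_law (X : R -> T -> R)
    (mu : probability R R) : Prop :=
  (\forall t \near +oo, measurable_fun setT (X t)) /\
  forall f : R -> R, continuous f -> bounded_fun f ->
    ('E_P[f \o X t])%E @[t --> +oo] --> (\int[mu]_x (f x)%:E)%E.

End Processes.

(* Main.v *)
Require Import Defs.
From mathcomp Require Import all_boot all_order all_algebra.
From mathcomp Require Import all_classical all_reals all_analysis.
From mathcomp Require Import measurable_realfun ring lra.
From mathcomp.real_closed Require Import complex.
Import Order.TTheory GRing.Theory Num.Theory.
Import numFieldNormedType.Exports.
Local Open Scope classical_set_scope.
Local Open Scope ring_scope.

(** Each coordinate X of Z solves a real equation
    X_t = x0 + B_t - lambda * int_0^t X_s ds driven by a Brownian motion B.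
    Convergence in law to the constant 0 follows from convergence in
    probability, and |log R_t| >= e * t forces one of the events
    |Re Z_t| <= exp (- e t), |Re Z_t| >= exp (e t) / 2,
    |Im Z_t| >= exp (e t) / 2.  It is therefore enough that a single coordinate
    X is neither exponentially small nor exponentially large, up to a
    probability that vanishes as t grows.

    Both estimates are obtained for the Euler scheme
    U_(k+1) = (1 - lambda * (t_(k+1) - t_k)) * U_k + (B_(t_(k+1)) - B_(t_k))
    and then transferred to X.  Since the noise is additive, the scheme
    converges path by path, by uniform continuity of the path of X
    ([euler_cvg]), hence in probability ([probability_euler_limit]).

    The scheme is useful because of an algebraic identity
    ([euler_decomposition]): started from U_a, after n steps it equals
    r * U_a + (B_v - B_u) + Rem, with u = t_a, v = t_(a+n), a deterministic r
    in [0, 1], and |Rem| at most the Riemann sum of lambda * |B_s - B_u| over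
    [u, v].  As E |B_s - B_u| <= 2 * sqrt (s - u), the mean of |Rem| is at most
    lambda * (v - u) * 2 * sqrt (v - u).
    - Taken from time 0, the identity gives a polynomial bound on E |U|, and
      Markov's inequality excludes exponentially large values ([large_tail_le]).
    - Taken over a last stretch of length h, it isolates a Gaussian increment
      of standard deviation sqrt h which is independent of r * U_a, so that
      r * U_a + (B_v - B_u) lies in a ball of radius del with probability at
      most 2 * del / sqrt h ([euler_anticoncentration]), whereas Rem exceeds del
      with probability at most 2 * lambda * h * sqrt h / del.  With h of the
      order of del both terms are O(sqrt del), which tends to 0 for
      del = exp (- e t) ([small_ball_le]).

    The independence of U_a and of the later increment comes from the
    independence of finitely many increments by the pi-lambda theorem
    ([past_independent]): U_a is measurable for the sigma-algebra generated by
    the cylinders over the increments before time t_a. *)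

(** * Gaussian estimates *)

Lemma normal_peak_le {R : realType} (s : R) : 0 < s -> normal_peak s <= s^-1.
Proof.
move=> s0; have s20 : 0 < s ^+ 2 by rewrite exprn_gt0.
have pi1 : 1 <= pi *+ 2 :> R by have := pi_ge2 R; lra.
rewrite /normal_peak lef_pV2 ?posrE//; last first.
  by rewrite sqrtr_gt0 pmulrn_rgt0// mulr_gt0 ?pi_gt0.
rewrite -[leLHS]gtr0_norm// -[leLHS]sqrtr_sqr ler_sqrt; last first.
  by rewrite mulrn_wge0// mulr_ge0 ?pi_ge0// ltW.
by rewrite -mulrnAr ler_peMr// ltW.
Qed.

Lemma normal_prob_ball_le {R : realType} (s c r : R) : 0 < s -> 0 <= r ->
  (normal_prob 0 s `[(c - r)%R, (c + r)%R]%classic <= (2 * r / s)%:E)%E.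
Proof.
move=> s0 r0; rewrite /normal_prob.
apply: (@le_trans _ _ (\int[lebesgue_measure]_(x in `[(c - r)%R, (c + r)%R]) (s^-1)%:E)%E).
  apply: ge0_le_integral => //=.
  - by move=> x _; rewrite lee_fin normal_pdf_ge0.
  - apply/measurable_EFinP; exact: (measurable_funS measurableT _ (measurable_normal_pdf _ _)).
  - by move=> x _; rewrite lee_fin (le_trans (normal_pdf_ub _ _ _)) ?gt_eqF// normal_peak_le.
rewrite integral_cst//= lebesgue_measure_itv/= lte_fin.
case: ifPn => _; last by rewrite mule0 lee_fin divr_ge0 ?mulr_ge0// ltW.
rewrite -EFinD -EFinM lee_fin le_eqVlt; apply/orP; left; apply/eqP; field; exact: lt0r_neq0.
Qed.

(** Over every measurable set, the Radon-Nikodym derivative and the density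
    integrate to the same probability, so they agree almost everywhere, and the
    change of variables for the derivative applies to the density. *)
Lemma integral_normal_prob {R : realType} (m s : R) (f : R -> \bar R) :
  measurable_fun setT f -> (forall x, (0 <= f x)%E) ->
  (\int[normal_prob m s]_x f x =
   \int[lebesgue_measure]_x (f x * (normal_pdf m s x)%:E))%E.
Proof.
move=> mf f0.
have dom : normal_prob m s `<< @lebesgue_measure R by exact: normal_prob_dominates.
rewrite -(Radon_Nikodym_SigmaFinite.change_of_variables dom f0)//.
set g := Radon_Nikodym_SigmaFinite.f _ _.
have mg : lebesgue_measure.-integrable setT g.
  exact: Radon_Nikodym_SigmaFinite.f_integrable.
have gp : ae_eq lebesgue_measure setT g (fun x => (normal_pdf m s x)%:E).
  apply: integral_ae_eq => //.
    by apply/measurable_EFinP; exact: measurable_normal_pdf.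
  by move=> E _ mE; rewrite -Radon_Nikodym_SigmaFinite.f_integral.
apply: ae_eq_integral => //.
- by apply: emeasurable_funM => //; exact: (measurable_int _ mg).
- apply: emeasurable_funM => //; apply/measurable_EFinP; exact: measurable_normal_pdf.
- by apply: filterS gp => x /= + /[dup] xT => /(_ xT) ->.
Qed.

(** The constant 2 is not sharp: comparing |x| times the density of N(0, s)
    with the density of N(0, 2s) avoids any computation of moments. *)
Lemma normal_prob_abs_moment {R : realType} (s : R) : 0 < s ->
  (\int[normal_prob 0 s]_x `|x|%:E <= (2 * s)%:E)%E.
Proof.
move=> s0; have s20 : 0 < 2 * s by rewrite mulr_gt0.
rewrite integral_normal_prob//; last first.
  by apply/measurable_EFinP; exact: normr_measurable.
apply: (@le_trans _ _
  (\int[lebesgue_measure]_x ((2 * s)%:E * (normal_pdf 0 (2 * s) x)%:E))%E); last first.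
  rewrite integralZl//; last exact: integrable_normal_pdf.
  by rewrite integral_normal_pdf mule1.
have mp t : measurable_fun setT (fun x : R => (normal_pdf 0 t x)%:E).
  by apply/measurable_EFinP; exact: measurable_normal_pdf.
apply: ge0_le_integral => //=.
- by move=> x _; rewrite mule_ge0 ?lee_fin ?normal_pdf_ge0.
- by apply: emeasurable_funM; [apply/measurable_EFinP; exact: normr_measurable|exact: mp].
- by apply: emeasurable_funM; [exact: measurable_cst|exact: mp].
move=> x _; rewrite -!EFinM lee_fin !normal_pdfE ?gt_eqF//.
have -> : normal_peak (2 * s) = normal_peak s / 2 :> R.
  rewrite /normal_peak -invfM; congr (_^-1).
  have -> : (2 * s) ^+ 2 * pi *+ 2 = 2 ^+ 2 * (s ^+ 2 * pi *+ 2) :> R by ring.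
  by rewrite sqrtrM ?sqr_ge0// sqrtr_sqr ger0_norm// mulrC.
rewrite /normal_fun !subr0.
set p := normal_peak s; have p0 : 0 <= p by exact: normal_peak_ge0.
(* After division by the peaks: with y = |x| / s this is y <= exp (3/8 y^2),
   a consequence of y <= 1 + 3/8 y^2. *)
suff h : `|x| * expR (- x ^+ 2 / (s ^+ 2 *+ 2)) <=
    s * expR (- x ^+ 2 / ((2 * s) ^+ 2 *+ 2)).
  rewrite mulrCA (_ : _ * (_ / _ * _) = p * (s * expR (- x ^+ 2 / ((2 * s) ^+ 2 *+ 2)))).
    exact: ler_wpM2l.
  by field.
have -> : - x ^+ 2 / ((2 * s) ^+ 2 *+ 2) =
    - x ^+ 2 / (s ^+ 2 *+ 2) + 3 / 8 * (`|x| / s) ^+ 2.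
  rewrite expr_div_n real_normK ?num_real//; field; exact: lt0r_neq0.
rewrite expRD mulrCA [leLHS]mulrC ler_wpM2l ?expR_ge0//.
rewrite -ler_pdivrMl// mulrC; apply: le_trans (expR_ge1Dx _).
have := sqr_ge0 (`|x| / s - 4 / 3); rewrite !expr2; lra.
Qed.

(** * The Euler scheme along a fixed path *)

Fixpoint euler {R : realType} (lambda x0 : R) (t : nat -> R) (b : R -> R) k : R :=
  if k is k'.+1 then
    (1 - lambda * (t k'.+1 - t k')) * euler lambda x0 t b k'
      + (b (t k'.+1) - b (t k'))
  else x0.

Lemma eq_euler {R : realType} (lambda x0 : R) (t t' : nat -> R) (b : R -> R) k :
  (forall i, (i <= k)%N -> t i = t' i) ->
  euler lambda x0 t b k = euler lambda x0 t' b k.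
Proof.
elim: k => //= k IH tt'; rewrite !tt'// IH// => i ik.
by apply: tt'; exact: leqW.
Qed.

Lemma Rintegral_near_cst {R : realType} (f : R -> R) (a b c e : R) : a <= b ->
  lebesgue_measure.-integrable `]a, b] (EFin \o f) ->
  (forall s, a < s <= b -> `|f s - c| <= e) ->
  `|\int[lebesgue_measure]_(s in `]a, b]) f s - (b - a) * c| <= (b - a) * e.
Proof.
move=> ab fi fc.
have cst_int (k : R) : \int[lebesgue_measure]_(s in `]a, b]) k = (b - a) * k.
  rewrite Rintegral_cst//= lebesgue_measure_itv/= lte_fin mulrC.
  case: ifPn => // /negPf abF.
  have ba : b = a by move: ab; rewrite le_eqVlt abF orbF => /eqP.
  by rewrite ba subrr /= !mul0r.
have icst (k : R) : lebesgue_measure.-integrable `]a, b] (EFin \o cst k).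
  apply: measurable_bounded_integrable => //.
    by rewrite /= lebesgue_measure_itv/=; case: ifP => // _; rewrite -EFinD ltry.
  exact: bounded_cst.
have fc' s : a < s <= b -> c - e <= f s /\ f s <= c + e.
  by move=> /fc; rewrite ler_norml => /andP[? ?]; lra.
have [L U] : (b - a) * (c - e) <= \int[lebesgue_measure]_(s in `]a, b]) f s /\
   \int[lebesgue_measure]_(s in `]a, b]) f s <= (b - a) * (c + e).
  rewrite -!cst_int; split.
    by apply: (le_Rintegral _ (icst _) fi) => //= s; rewrite in_itv/= => /fc'[].
  by apply: (le_Rintegral _ fi (icst _)) => //= s; rewrite in_itv/= => /fc'[].
move: L U; rewrite mulrBr mulrDr => L U.
by rewrite ler_norml lerBrDr lerBlDr ![_ + (b - a) * c]addrC L U.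
Qed.

(** Heine's theorem on [0, t], with the uniform radius provided by the
    near-covering form of compactness. *)
Lemma continuous_path_unif {R : realType} (x : R -> R) (t e : R) :
  continuous_path x -> 0 < e ->
  exists2 del, 0 < del & forall r s, 0 <= r <= t -> 0 <= s <= t ->
    `|r - s| < del -> `|x r - x s| <= e.
Proof.
move=> cx e0.
have cx' (y : R) : 0 <= y ->
    exists2 d, 0 < d & forall z, 0 <= z -> `|y - z| < d -> `|x y - x z| < e / 2.
  move=> y0; move/subspace_continuousP : cx => /(_ y).
  rewrite /= in_itv/= y0 => /(_ isT)/cvgrPdist_lt/(_ (e / 2)).
  rewrite divr_gt0// => /(_ isT) /nbhs_ballP[d/= d0 H].
  exists d => // z z0 yz; apply: H => //.
  by rewrite /= in_itv/= z0.
have := @segment_compact R 0 t.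
rewrite compact_near_coveringP => cov.
pose Q (i : R) (r : R) := forall s, 0 <= r <= t -> 0 <= s <= t -> `|r - s| < i ->
     `|x r - x s| <= e.
have /cov : forall y : R, `[0, t]%classic y ->
   \forall y' \near y & i \near (0^'+ : set_system R), Q i y'.
  move=> y /=; rewrite in_itv/= => /andP[y0 yt].
  have [d d0 Hd] := cx' _ y0.
  exists (ball y (d / 2), [set i | i < d / 2]).
    split => /=; first by apply: nbhsx_ballx; rewrite divr_gt0.
    by apply: nbhs_right_lt; rewrite divr_gt0.
  move=> [y' i] /= [yy' id] s /andP[y'0 y't] /andP[s0 st] ys.
  have h1 : `|x y - x y'| < e / 2.
    by apply: Hd => //; move: yy'; rewrite /ball/=; move/lt_le_trans; apply; lra.
  have h2 : `|x y - x s| < e / 2.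
    apply: Hd => //; rewrite (_ : y - s = (y - y') + (y' - s)); last by ring.
    by apply: (le_lt_trans (ler_normD _ _)); move: yy'; rewrite /ball/=; lra.
  rewrite (_ : _ - _ = (x y - x s) - (x y - x y')); last by ring.
  by apply: (le_trans (ler_normB _ _)); lra.
move=> [d /= d0 H]; exists (d / 2); first by rewrite divr_gt0.
move=> r s rt st rs.
have : ball_ Num.norm 0 d (d / 2).
  by rewrite /ball_/= sub0r normrN gtr0_norm; lra.
move=> /H; rewrite divr_gt0// => /(_ isT r).
by rewrite /= in_itv/= rt => /(_ isT); apply.
Qed.

(** The noise enters the scheme and the equation in the same way, so only the
    oscillation of the solution inside a cell produces an error. *)
Lemma euler_error {R : realType} (lambda x0 e : R) (x b : R -> R) (t : nat -> R) N :
  0 <= lambda -> continuous_path x -> b 0 = 0 ->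
  (forall s, 0 <= s ->
     x s = x0 + b s - lambda * \int[lebesgue_measure]_(r in `[0, s]) x r) ->
  t 0%N = 0 -> {homo t : i j / (i <= j)%N >-> i <= j} ->
  (forall k, lambda * (t k.+1 - t k) <= 1) ->
  (forall k s, (k < N)%N -> t k <= s <= t k.+1 -> `|x s - x (t k)| <= e) ->
  forall k, (k <= N)%N -> `|x (t k) - euler lambda x0 t b k| <= lambda * t k * e.
Proof.
move=> l0 cx b0 xE t0 th tl osc.
have tp k : 0 <= t k by rewrite -t0 th.
have xi s : 0 <= s -> lebesgue_measure.-integrable `[0, s] (EFin \o x).
  move=> s0; apply: continuous_compact_integrable; first exact: segment_compact.
  by apply: continuous_subspaceW cx => r /=; rewrite !in_itv/= => /andP[->].
elim=> [_|k IH kN] /=.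
  rewrite t0 xE// b0 set_itv1 Rintegral_set1 !(mulr0,mul0r,addr0,subr0).
  by rewrite subrr normr0.
have tk := th _ _ (leqnSn k).
have := IH (ltnW kN); set u := euler _ _ _ _ _ => {}IH.
(* One step multiplies the error by 1 - lambda * (t_(k+1) - t_k), which lies in
   [0, 1], and adds the error made by freezing x at time t_k. *)
have step : x (t k.+1) = x (t k) + (b (t k.+1) - b (t k)) -
    lambda * \int[lebesgue_measure]_(r in `]t k, t k.+1]) x r.
  rewrite !xE// -(@Rintegral_itvB _ x (BLeft 0) (BRight (t k.+1)) (t k)) ?bnd_simp//.
    ring.
  exact: xi.
have i2 : lebesgue_measure.-integrable `]t k, t k.+1] (EFin \o x).
  apply: integrableS (xi _ (tp k.+1)) => //.
  by apply: subset_itvr; rewrite bnd_simp.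
have oscs s : t k < s <= t k.+1 -> `|x s - x (t k)| <= e.
  by move=> /andP[ks sk]; apply: osc => //; rewrite (ltW ks) sk.
have := Rintegral_near_cst _ _ _ _ _ tk i2 oscs.
rewrite step; set I := Rintegral _ _ _ => HI.
have -> : x (t k) + (b (t k.+1) - b (t k)) - lambda * I -
  ((1 - lambda * (t k.+1 - t k)) * u + (b (t k.+1) - b (t k))) =
  (1 - lambda * (t k.+1 - t k)) * (x (t k) - u) -
  lambda * (I - (t k.+1 - t k) * x (t k)) by ring.
apply: (le_trans (ler_normB _ _)); rewrite !normrM (ger0_norm l0).
rewrite (_ : lambda * t k.+1 * e = lambda * t k * e + lambda * ((t k.+1 - t k) * e)); last by ring.
apply: lerD; last exact: ler_wpM2l.
rewrite ger0_norm; last by have := tl k; lra.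
apply: le_trans IH; rewrite ler_piMl//.
by have : 0 <= lambda * (t k.+1 - t k); [rewrite mulr_ge0// subr_ge0|lra].
Qed.

(** The scheme over the last n steps, seen as the noise accumulated since the
    step a plus a small remainder.  The defect D of this identity obeys
    D_(k+1) = (1 - lambda * eta) * D_k - lambda * eta * (b_k - b_a), where eta is
    the length of the step, hence the bound. *)
Lemma euler_decomposition {R : realType} (lambda x0 : R) (t : nat -> R) (b : R -> R) a n :
  0 <= lambda -> {homo t : i j / (i <= j)%N >-> i <= j} ->
  (forall k, lambda * (t k.+1 - t k) <= 1) ->
  `|euler lambda x0 t b (a + n) -
    (\prod_(i < n) (1 - lambda * (t (a + i).+1 - t (a + i)%N)) * euler lambda x0 t b a +
     (b (t (a + n)%N) - b (t a)))| <=
  \sum_(i < n) lambda * (t (a + i).+1 - t (a + i)%N) * `|b (t (a + i)%N) - b (t a)|.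
Proof.
move=> l0 th tl; elim: n => [|n IH].
  by rewrite !big_ord0 addn0 mul1r subrr addr0 subrr normr0.
rewrite addnS/= !big_ord_recr/=.
move: IH; set u := euler _ _ _ _ (a + n); set ua := euler _ _ _ _ a.
set p := \prod_(i < n) _; set S := \sum_(i < n) _ => IH.
set h := t (a + n).+1 - t (a + n)%N.
have lh0 : 0 <= lambda * h by rewrite mulr_ge0// subr_ge0 th.
rewrite (_ : _ - _ = (1 - lambda * h) * (u - (p * ua + (b (t (a + n)%N) - b (t a)))) -
   lambda * h * (b (t (a + n)%N) - b (t a))); last by ring.
apply: (le_trans (ler_normB _ _)); rewrite (normrM (1 - _)) (normrM (lambda * h)) (ger0_norm lh0).
rewrite lerD2r; apply: le_trans IH; rewrite ler_piMl//.
have := tl (a + n)%N; rewrite -/h => lh1; rewrite ger0_norm; [lra|rewrite subr_ge0; exact: lh1].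
Qed.

Definition uniform_grid {R : realType} (t : R) (N i : nat) : R := i%:R * (t / N%:R).

Lemma uniform_grid_homo {R : realType} (t : R) N : 0 <= t ->
  {homo uniform_grid t N : i j / (i <= j)%N >-> i <= j}.
Proof. by move=> t0 i j ij; rewrite ler_wpM2r ?divr_ge0// ler_nat. Qed.

Lemma uniform_gridS {R : realType} (t : R) N i :
  uniform_grid t N i.+1 - uniform_grid t N i = t / N%:R.
Proof. by rewrite /uniform_grid -natr1; ring. Qed.

Lemma uniform_grid0 {R : realType} (t : R) N : uniform_grid t N 0 = 0.
Proof. by rewrite /uniform_grid mul0r. Qed.

Lemma uniform_grid_end {R : realType} (t : R) N : (0 < N)%N -> uniform_grid t N N = t.
Proof. by move=> N0; rewrite /uniform_grid mulrC divfK// pnatr_eq0 -lt0n. Qed.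

Lemma euler_cvg {R : realType} (lambda x0 t : R) (x b : R -> R) (del : R) :
  0 <= lambda -> 0 < t -> 0 < del -> continuous_path x -> b 0 = 0 ->
  (forall s, 0 <= s ->
     x s = x0 + b s - lambda * \int[lebesgue_measure]_(r in `[0, s]) x r) ->
  \forall N \near \oo, `|x t - euler lambda x0 (uniform_grid t N) b N| < del.
Proof.
move=> l0 t0 del0 cx b0 xE.
have lt1 : 0 < lambda * t + 1 by rewrite ltr_wpDl// mulr_ge0// ltW.
pose e := del / (lambda * t + 1).
have e0 : 0 < e by rewrite divr_gt0.
have [r r0 Hr] := continuous_path_unif x t e cx e0.
near=> N.
have N0 : (0 < N)%N by near: N; exact: nbhs_infty_gt.
have NR0 : 0 < N%:R :> R by rewrite ltr0n.
have Nr : t / N%:R < r.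
  by rewrite ltr_pdivrMr// mulrC -ltr_pdivrMr//; near: N; exact: nbhs_infty_gtr.
have Nl : lambda * (t / N%:R) <= 1.
  by rewrite mulrA ler_pdivrMr// mul1r ltW//; near: N; exact: nbhs_infty_gtr.
have th := uniform_grid_homo t N (ltW t0).
have := euler_error lambda x0 e x b (uniform_grid t N) N l0 cx b0 xE
  (uniform_grid0 t N) th.
have tl k : lambda * (uniform_grid t N k.+1 - uniform_grid t N k) <= 1.
  by rewrite uniform_gridS.
move=> /(_ tl) H.
have {H} := H _ _ (leqnn N); rewrite {1 2}uniform_grid_end// => H.
apply: (le_lt_trans (H _)).
  move=> k s kN /andP[ks sk].
  have tk0 : 0 <= uniform_grid t N k by rewrite -(uniform_grid0 t N) th.
  have kt : uniform_grid t N k.+1 <= t by rewrite -[leRHS](uniform_grid_end t N N0) th.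
  apply: Hr.
  - by rewrite (le_trans tk0 ks) (le_trans sk kt).
  - by rewrite tk0 (le_trans ks (le_trans sk kt)).
  - rewrite ger0_norm ?subr_ge0//; apply: le_lt_trans Nr.
    by rewrite -(uniform_gridS t N k) lerB.
by rewrite /e mulrA ltr_pdivrMr// mulrC ltr_pM2l//; lra.
Unshelve. all: by end_near. Qed.

(** * Convergence in probability and in law *)

Section ProbabilityBounds.
Context {d : measure_display} {T : measurableType d} {R : realType}.
Variable P : probability T R.

Lemma measurable_superlevel (f : T -> R) c : measurable_fun setT f ->
  measurable [set w | c <= f w].
Proof.
move=> mf; rewrite (_ : [set _ | _] = f @^-1` `[c, +oo[%classic).
  by rewrite -[X in measurable X]setTI; exact: mf.
by apply/seteqP; split => w /=; rewrite in_itv/= andbT.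
Qed.

Lemma measurable_sublevel (f : T -> R) c : measurable_fun setT f ->
  measurable [set w | f w <= c].
Proof.
move=> mf; rewrite (_ : [set _ | _] = f @^-1` `]-oo, c]%classic).
  by rewrite -[X in measurable X]setTI; exact: mf.
by apply/seteqP; split => w /=; rewrite in_itv.
Qed.

Lemma probability_cover2 (A A1 A2 : set T) (a1 a2 : R) :
  measurable A -> measurable A1 -> measurable A2 -> A `<=` A1 `|` A2 ->
  (P A1 <= a1%:E)%E -> (P A2 <= a2%:E)%E -> (P A <= (a1 + a2)%:E)%E.
Proof.
move=> mA m1 m2 AA p1 p2.
apply: (@le_trans _ _ (P (A1 `|` A2))).
  by apply: le_measure; rewrite ?inE//; exact: measurableU.
by rewrite EFinD; apply: (le_trans (measureU2 _ m1 m2)); exact: leeD.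
Qed.

Lemma markov_le (f : T -> R) (c M : R) : 0 < c ->
  measurable_fun setT f -> (forall w, 0 <= f w) ->
  (\int[P]_w (f w)%:E <= M%:E)%E -> (P [set w | c <= f w]%R <= (M / c)%:E)%E.
Proof.
move=> c0 mf f0 fM.
rewrite EFinM lee_pdivlMr// muleC; apply: le_trans fM.
have := @le_integral_comp_abse _ _ _ P _ measurableT (EFin \o f) c id
  (@measurable_id _ _ _) (fun r r0 => r0) (fun x y _ _ xy => xy).
rewrite setTI => /(_ _ c0) H.
apply: (le_trans _ (le_trans (H _) _)); last 2 first.
- exact/measurable_EFinP.
- by under eq_integral do rewrite /= ger0_norm//.
- rewrite le_eqVlt; apply/orP; left; apply/eqP; congr (_ * P _)%E.
  by apply/seteqP; split => w /=; rewrite lee_fin ger0_norm.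
Qed.

(** Almost sure convergence implies convergence in probability: dominated
    convergence for the indicators of the exceptional events. *)
Lemma cvg_probability_ae_eventually (A : nat -> set T) : (forall n, measurable (A n)) ->
  {ae P, forall w, \forall n \near \oo, ~ A n w} -> P (A n) @[n --> \oo] --> 0%E.
Proof.
move=> mA aeA.
have iP n : P (A n) = (\int[P]_w (\1_(A n) w)%:E)%E by rewrite integral_indic// setIT.
under eq_fun do rewrite iP.
have [|||||_ _] := @dominated_convergence _ T R P setT measurableT
  (fun n w => (\1_(A n) w)%:E) (cst 0%E) (cst 1%E).
- by move=> n; apply/measurable_EFinP; exact: measurable_indic.
- exact: measurable_cst.
- apply: filterS aeA => w Aw _; apply: cvg_near_cst.
  by near=> n; rewrite indicE memNset//; near: n.
- exact: finite_measure_integrable_cst.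
- by apply: aeW => w n _; rewrite /= lee_fin ger0_norm// indicE; case: (_ \in _).
- by rewrite integral0.
Unshelve. all: by end_near. Qed.

Lemma integral_le_indic (g : T -> R) (A : set T) (c k : R) :
  P.-integrable setT (EFin \o g) -> measurable A ->
  (forall w, g w <= c + k * \1_A w) ->
  (\int[P]_w (g w)%:E <= (c + k * fine (P A))%:E)%E.
Proof.
move=> ig mA gA.
have iA : P.-integrable setT (fun w => (\1_A w)%:E) by exact: integrable_indic.
have ikA : P.-integrable setT (fun w => k%:E * (\1_A w)%:E)%E.
  exact: integrableZl.
have ic : P.-integrable setT (EFin \o cst c) by exact: finite_measure_integrable_cst.
apply: (@le_trans _ _ (\int[P]_w (c%:E + k%:E * (\1_A w)%:E))%E).
  apply: le_integral => //; first exact: (integrableD measurableT ic ikA).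
  by move=> w _; rewrite -EFinM -EFinD lee_fin.
rewrite integralD//= integral_cst//= probability_setT mule1.
rewrite integralZl// integral_indic// setIT EFinD EFinM fineK//.
exact: fin_num_measure.
Qed.

(** Convergence in probability to 0 implies convergence in law to 0: for f
    bounded by M, |f 0 - f V| is at most e / 2 where V is close to 0, and at
    most 2 * M on the complementary event, which has small probability. *)
Lemma cvg_probability_law0 (V : R -> T -> R) :
  (\forall t \near +oo, measurable_fun setT (V t)) ->
  (forall e eta : R, 0 < e -> 0 < eta ->
     \forall t \near +oo, (P [set w | e <= `|V t w|]%R <= eta%:E)%E) ->
  converges_in_law P V \d_(0 : R).
Proof.
move=> mV V0; split=> // f cf bf.
have mf : measurable_fun setT f by exact: continuous_measurable_fun.
rewrite integral_dirac//; last exact/measurable_EFinP.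
rewrite diracT mul1e.
have [M M0 fM] : exists2 M, 0 < M & forall x, `|f x| <= M.
  have [M0 [_ HM]] := bf.
  exists (`|M0| + 1); first by rewrite ltr_wpDl.
  by move=> x; apply: HM => //; rewrite (le_lt_trans (ler_norm _))// ltrDl.
have iV t : measurable_fun setT (V t) -> P.-integrable setT (EFin \o (f \o V t)).
  move=> mVt; apply: (@measurable_bounded_integrable _ _ _ P (f \o V t)) => //.
  - by rewrite fin_num_fun_lty.
  - exact: measurableT_comp.
  exists M; split; first exact: num_real.
  by move=> y My w _; exact: le_trans (fM _) (ltW My).
rewrite unlock; apply/fine_cvgP; split.
  by apply: filterS mV => t /iV; exact: integrable_fin_num.
apply/cvgrPdist_le => e e0.
have e20 : 0 < e / 2 by rewrite divr_gt0.
have /cvgrPdist_le/(_ _ e20)/nbhs_ballP[r /= r0 Hr] := cf 0.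
near=> t.
have mVt : measurable_fun setT (V t) by near: t.
have PA' : (P [set w | r <= `|V t w|]%R <= (e / 2 / (2 * M))%:E)%E.
  by near: t; apply: V0 => //; rewrite !divr_gt0// mulr_gt0.
pose A := [set w | r <= `|V t w|].
have mA : measurable A by apply: measurable_superlevel; apply: measurableT_comp; first exact: normr_measurable.
have PA : fine (P A) <= e / 2 / (2 * M).
  rewrite -lee_fin fineK ?fin_num_measure//.
have key w : `|f 0 - f (V t w)| <= e / 2 + 2 * M * \1_A w.
  rewrite indicE; have [wA|/negP wA] := boolP (w \in A).
    rewrite mulr1; apply: (le_trans (ler_normB _ _)).
    by have := fM 0; have := fM (V t w); lra.
  rewrite mulr0 addr0; apply: Hr; rewrite /ball/= sub0r normrN ltNge.
  by apply/negP => rV; apply: wA; rewrite inE.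
have MA : 2 * M * fine (P A) <= e / 2.
  by rewrite mulrC -ler_pdivlMr// mulr_gt0.
have fin : (\int[P]_w (f (V t w))%:E)%E \is a fin_num by exact: integrable_fin_num (iV _ mVt).
have U : (\int[P]_w (f (V t w))%:E <= (f 0 + e / 2 + 2 * M * fine (P A))%:E)%E.
  apply: integral_le_indic => // [|w]; first exact: iV.
  by have := key w; rewrite ler_norml => /andP[? ?]; lra.
have L : (\int[P]_w (- f (V t w))%:E <= (- f 0 + e / 2 + 2 * M * fine (P A))%:E)%E.
  apply: integral_le_indic => // [|w].
    have -> : EFin \o (fun w => - f (V t w)) = (\- (EFin \o (f \o V t)))%E by [].
    by apply: integrableN; exact: iV.
  by have := key w; rewrite ler_norml => /andP[? ?]; lra.
move: L; under eq_integral do rewrite EFinN.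
rewrite integralN/=; last by apply: integrable_add_def => //; exact: iV.
move: U fin; rewrite /comp/=; case: (integral _ _ _) => // z; rewrite !lee_fin => U _ L.
by rewrite /= ler_norml; apply/andP; split; lra.
Unshelve. all: by end_near. Qed.

End ProbabilityBounds.

(** * Independence of the past and anticoncentration *)

Section Independence.
Context {d : measure_display} {T : measurableType d} {R : realType}.
Variable P : probability T R.

Definition cylinders (n : nat) (X : nat -> T -> R) : set (set T) :=
  [set C | exists2 A : nat -> set R, (forall i, measurable (A i)) &
     C = \bigcap_(i in `I_n) (X i @^-1` A i)].

Lemma cylindersI n X : setI_closed (cylinders n X).
Proof.
move=> _ _ [A mA ->] [A' mA' ->]; exists (fun i => A i `&` A' i).
  by move=> i; exact: measurableI.
by rewrite -bigcapI.
Qed.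

(** The events independent of X n form a Dynkin system, which contains the
    cylinders by the product rule (with the whole line as the constraint on
    X n to compute the probability of a cylinder). *)
Lemma past_independent n (X : nat -> T -> R) :
  (forall i, (i <= n)%N -> measurable_fun setT (X i)) ->
  mutually_independent P (fun i : 'I_n.+1 => X i) ->
  forall C A, <<s cylinders n X >> C -> measurable A ->
    P (C `&` X n @^-1` A) = (P C * P (X n @^-1` A))%E.
Proof.
move=> mX ind C A + mA.
have mXA i B : (i <= n)%N -> measurable B -> measurable (X i @^-1` B).
  by move=> /mX mXi mB; rewrite -[X in measurable X]setTI; exact: mXi.
have mXn := mXA n A (leqnn n) mA.
suff : <<s cylinders n X >> `<=`
   [set C | measurable C /\ P (C `&` X n @^-1` A) = (P C * P (X n @^-1` A))%E].
  by move=> /[apply] -[].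
have fin B : measurable B -> P B \is a fin_num by exact: fin_num_measure.
apply: lambda_system_subset => //; first exact: cylindersI; last first.
  move=> _ [B mB ->].
  pose B' i := if (i < n)%N then B i else setT.
  have mB' i : measurable (B' i) by rewrite /B'; case: ifP.
  have prodE (E : set R) : measurable E ->
      P (\bigcap_(i in `I_n) (X i @^-1` B i) `&` X n @^-1` E) =
      ((\prod_(i < n) P (X i @^-1` B i)) * P (X n @^-1` E))%E.
    move=> mE; pose BE i := if (i < n)%N then B i else E.
    have mBE i : measurable (BE i) by rewrite /BE; case: ifP.
    have := ind (fun i => BE i) (fun i => mBE i).
    have BEn : BE n = E by rewrite /BE ltnn.
    have BEi i : (i < n)%N -> BE i = B i by rewrite /BE => ->.
    rewrite big_ord_recr/= BEn; under eq_bigr => i _ do rewrite BEi//.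
    move=> <-; congr (P _); apply/seteqP; split => w /=.
      move=> [wB wE] i _ /=; have := ltn_ord i.
      rewrite ltnS leq_eqVlt => /predU1P[->|iltn]; first by rewrite BEn.
      by rewrite BEi//; exact: wB.
    move=> wB; split; last by have := wB ord_max I; rewrite /= BEn.
    by move=> i iltn; have := wB (Ordinal (ltnW iltn : (i < n.+1)%N)) I; rewrite /= BEi.
  split.
    by apply: bigcap_measurableType => i /= /ltnW ?; exact: mXA.
  rewrite prodE//; congr (_ * _)%E.
  by have := prodE setT measurableT; rewrite preimage_setT setIT probability_setT mule1 => ->.
apply/dynkin_lambda_system; split => //.
- by split => //; rewrite setTI probability_setT mul1e.
- move=> E [mE PE]; split; first exact: measurableC.
  rewrite setIC -setDE measureD//; last by rewrite ltey_eq fin.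
  rewrite probability_setC// [X in (_ - P X)%E]setIC PE muleBl ?fin// ?mul1e//.
- move=> F tF HF; split; first by apply: bigcupT_measurable => i; have [] := HF i.
  have mF i : measurable (F i) by have [] := HF i.
  have mFX i : measurable (F i `&` X n @^-1` A) by exact: measurableI.
  have tFX : trivIset setT (fun i => F i `&` X n @^-1` A) by exact: trivIset_setIr.
  rewrite setI_bigcupl (measure_bigcup P _ _ (fun i _ => mFX i) tFX).
  rewrite (measure_bigcup P _ _ (fun i _ => mF i) tF).
  rewrite (eq_eseriesr (fun i _ => (HF i).2)).
  under eq_eseriesr => i _ do rewrite muleC.
  by rewrite -(fineK (fin _ mXn)) nneseriesZl// muleC.
Qed.

(** The joint law of S and Y is a product, so by Fubini the probability is an
    average over x of the normal measure of a ball centred at - x. *)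
Lemma indep_normal_anticoncentration (S Y : T -> R) (s del : R) : 0 < s -> 0 <= del ->
  measurable_fun setT S -> measurable_fun setT Y ->
  (forall A B, measurable A -> measurable B ->
     P (S @^-1` A `&` Y @^-1` B) = (P (S @^-1` A) * P (Y @^-1` B))%E) ->
  (forall A, measurable A -> P (Y @^-1` A) = normal_prob 0 s A) ->
  (P [set w | `|S w + Y w| <= del]%R <= (2 * del / s)%:E)%E.
Proof.
move=> s0 del0 mS mY indep nY.
pose D : set (R * R) := [set z | `|z.1 + z.2| <= del].
have mD : measurable D.
  rewrite (_ : D = (fun z : R * R => `|z.1 + z.2|) @^-1` `]-oo, del]%classic); last first.
    by apply/seteqP; split => z; rewrite /= in_itv.
  rewrite -[X in measurable X]setTI; apply: (_ : measurable_fun setT _) => //.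
  by apply: measurableT_comp => //; apply: measurable_funD.
have mSY : measurable_fun setT (fun w => (S w, Y w)) by exact: measurable_fun_pair.
pose Sm : {mfun T >-> R} := mfun_Sub (mem_set mS).
pose Ym : {mfun T >-> R} := mfun_Sub (mem_set mY).
pose SYm : {mfun T >-> (R * R)%type} := mfun_Sub (mem_set mSY).
have DE : (distribution P Sm \x distribution P Ym)%E D =
    P [set w | `|S w + Y w| <= del]%R.
  rewrite (product_measure_unique (m' := distribution P SYm))//; exact: indep.
rewrite -DE /product_measure1 /=.
apply: (@le_trans _ _ (\int[distribution P Sm]_x (2 * del / s)%:E)%E); last first.
  by rewrite integral_cst//= probability_setT mule1.
apply: ge0_le_integral => //=.
- exact: measurable_fun_xsection.
move=> x _; rewrite [leLHS]nY; last exact: measurable_xsection.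
apply: (le_trans _ (normal_prob_ball_le s (- x) del s0 del0)).
apply: le_measure; rewrite ?inE//; first exact: measurable_xsection.
move=> y; rewrite /xsection/= inE /D/= in_itv/= ler_norml.
by move=> /andP[? ?]; apply/andP; split; lra.
Qed.

(** Read inside the sigma-algebra of the past, the scheme is a finite affine
    combination of the increments. *)
Lemma euler_past_measurable (lambda x0 : R) (t : nat -> R) (B : R -> T -> R) n k : (k <= n)%N ->
  forall A, measurable A ->
  <<s cylinders n (fun i w => B (t i.+1) w - B (t i) w) >>
    ((fun w => euler lambda x0 t (B ^~ w) k) @^-1` A).
Proof.
set X := fun i w => _.
have mX i : (i < n)%N ->
    @measurable_fun _ _ (g_sigma_algebraType (cylinders n X)) R setT (X i).
  move=> iltn _ A mA; rewrite setTI; apply: sub_sigma_algebra.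
  exists (fun j => if j == i then A else setT); first by move=> j; case: ifP.
  apply/seteqP; split => w /=.
    by move=> Aw j _ /=; case: eqP => // ->.
  by move=> /(_ i iltn) /=; rewrite eqxx.
have : (k <= n)%N -> @measurable_fun _ _ (g_sigma_algebraType (cylinders n X)) R setT
   (fun w => euler lambda x0 t (B ^~ w) k).
  elim: k => [_|k IH kn] /=; first exact: measurable_cst.
  apply: measurable_funD; last exact: mX.
  by apply: measurable_funM; [exact: measurable_cst|exact: IH (ltnW kn)].
move=> + kn => /(_ kn) h A mA.
by have := h measurableT A mA; rewrite setTI.
Qed.

End Independence.

(** * The Euler scheme driven by a Brownian motion *)

Section BrownianEuler.
Context {d : measure_display} {T : measurableType d} {R : realType}.
Variables (P : probability T R) (B : R -> T -> R).
Hypothesis hB : standard_brownian_motion P B.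

Lemma measurable_increment (s t : R) : 0 <= s -> 0 <= t ->
  measurable_fun setT (fun w => B t w - B s w).
Proof.
by move=> s0 t0; apply: measurable_funB; apply: (sbm_measurable hB).
Qed.

Lemma measurable_euler (lambda x0 : R) (t : nat -> R) k : (forall i, 0 <= t i) ->
  measurable_fun setT (fun w => euler lambda x0 t (B ^~ w) k).
Proof.
move=> t0; elim: k => [|k IH] /=; first exact: measurable_cst.
apply: measurable_funD; last exact: measurable_increment.
by apply: measurable_funM; [exact: measurable_cst|].
Qed.

Lemma euler_independent_increment (lambda x0 : R) (t : nat -> R) a v : 0 <= t 0%N ->
  {homo t : i j / (i <= j)%N >-> i <= j} -> t a <= v ->
  forall A C, measurable A -> measurable C ->
    P ((fun w => euler lambda x0 t (B ^~ w) a) @^-1` A `&`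
       (fun w => B v w - B (t a) w) @^-1` C) =
    (P ((fun w => euler lambda x0 t (B ^~ w) a) @^-1` A) *
     P ((fun w => B v w - B (t a) w)%R @^-1` C))%E.
Proof.
move=> t0 th tav A C mA mC.
(* Freezing the grid at v after the step a turns the increment over [t_a, v]
   into the increment number a of a grid that agrees with t up to a. *)
pose t' i := if (i <= a)%N then t i else v.
have t'h : {homo t' : i j / (i <= j)%N >-> i <= j}.
  move=> i j ij; rewrite /t'; case: (leqP j a) => [ja|aj].
    by rewrite (leq_trans ij ja) th.
  by case: leqP => // ia; rewrite (le_trans (th _ _ ia)).
have t'0 : 0 <= t' 0%N by rewrite /t'.
pose X i w := B (t' i.+1) w - B (t' i) w.
have mX i : (i <= a)%N -> measurable_fun setT (X i).
  by move=> _; apply: measurable_increment; rewrite (le_trans t'0)// t'h.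
have := past_independent P a X mX (sbm_independent_increments hB t'0 t'h) _ _
  (euler_past_measurable lambda x0 t' B a a (leqnn a) _ mA) mC.
have -> : X a = (fun w => B v w - B (t a) w).
  by rewrite /X /t' ltnn leqnn.
have -> // : (fun w => euler lambda x0 t' (B ^~ w) a) =
    (fun w => euler lambda x0 t (B ^~ w) a).
  by apply/funext => w; apply: eq_euler => i ia; rewrite /t' ia.
Qed.

Lemma increment_abs_moment (s t : R) : 0 <= s -> s <= t ->
  (\int[P]_w `|B t w - B s w|%:E <= (2 * Num.sqrt (t - s))%:E)%E.
Proof.
move=> s0; rewrite le_eqVlt => /predU1P[->|st].
  rewrite (eq_integral (cst 0%E)); last by move=> w _; rewrite subrr normr0.
  by rewrite integral0 lee_fin mulr_ge0 ?sqrtr_ge0.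
have t0 : 0 <= t by rewrite (le_trans s0) ?ltW.
have mY := measurable_increment s t s0 t0.
have d0 : 0 < Num.sqrt (t - s) by rewrite sqrtr_gt0 subr_gt0.
apply: le_trans (normal_prob_abs_moment _ d0).
(* normal_prob is a measure on the sigma-algebra generated by the intervals,
   so the increment is retyped with that structure on its codomain. *)
have mY' : @measurable_fun _ _ T (measurableTypeR R) setT (fun w => B t w - B s w) := mY.
pose Y := @mfun_Sub _ _ T (measurableTypeR R) (fun w => B t w - B s w) (mem_set mY').
have mn : measurable_fun [set: measurableTypeR R] (fun x => `|x|%:E).
  by apply/measurable_EFinP; exact: normr_measurable.
rewrite -[leLHS](ge0_integral_distribution Y mn)//.
rewrite le_eqVlt; apply/orP; left; apply/eqP.
by apply: eq_measure_integral => A mA _; exact: (sbm_normal_increments hB).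
Qed.

Lemma euler_anticoncentration (lambda x0 r del : R) (t : nat -> R) a v : 0 <= t 0%N ->
  {homo t : i j / (i <= j)%N >-> i <= j} -> t a < v -> 0 <= del ->
  (P [set w | `|r * euler lambda x0 t (B ^~ w) a + (B v w - B (t a) w)| <= del]%R
     <= (2 * del / Num.sqrt (v - t a))%:E)%E.
Proof.
move=> t0 th tav del0.
have tp i : 0 <= t i by rewrite (le_trans t0)// th.
have v0 : 0 <= v by rewrite (le_trans (tp a))// ltW.
have mU := measurable_euler lambda x0 t a tp.
apply: indep_normal_anticoncentration => //.
- by rewrite sqrtr_gt0 subr_gt0.
- by apply: measurable_funM => //; exact: measurable_cst.
- exact: measurable_increment.
- move=> A C mA mC.
  have mrA : measurable [set x : R | A (r * x)].
    rewrite -[X in measurable X]setTI.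
    have : measurable_fun setT (fun x : R => r * x) by apply: measurable_funM.
    exact.
  exact: (euler_independent_increment _ _ _ _ _ t0 th (ltW tav) _ _ mrA mC).
- by move=> A mA; rewrite (sbm_normal_increments hB).
Qed.

Lemma euler_remainder_moment (lambda : R) (t : nat -> R) a n : 0 <= lambda ->
  0 <= t 0%N -> {homo t : i j / (i <= j)%N >-> i <= j} ->
  (\int[P]_w (\sum_(i < n) lambda * (t (a + i).+1 - t (a + i)%N) *
      `|B (t (a + i)%N) w - B (t a) w|)%:E <=
   (lambda * (t (a + n)%N - t a) * (2 * Num.sqrt (t (a + n)%N - t a)))%:E)%E.
Proof.
move=> l0 t0 th.
have tp i : 0 <= t i by rewrite (le_trans t0)// th.
under eq_integral do rewrite -sumEFin.
have c0 i : 0 <= lambda * (t (a + i).+1 - t (a + i)%N).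
  by rewrite mulr_ge0// subr_ge0 th.
have mi i : measurable_fun setT (fun w => `|B (t (a + i)%N) w - B (t a) w|).
  apply: measurableT_comp; first exact: normr_measurable.
  exact: measurable_increment.
rewrite ge0_integral_sum//; first last.
- by move=> i w _; rewrite lee_fin mulr_ge0.
- move=> i; apply/measurable_EFinP.
  by apply: measurable_funM; [exact: measurable_cst|exact: mi].
set s := 2 * Num.sqrt _.
apply: (@le_trans _ _ (\sum_(i < n) (lambda * (t (a + i).+1 - t (a + i)%N) * s)%:E)%E).
  apply: lee_sum => i _.
  under eq_integral do rewrite EFinM.
  rewrite ge0_integralZl//; [|exact/measurable_EFinP|by rewrite lee_fin; exact: c0].
  rewrite [leRHS]EFinM lee_wpmul2l ?lee_fin ?c0//.
  apply: (le_trans (increment_abs_moment _ _ (tp a) (th _ _ (leq_addr _ _)))).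
  rewrite lee_fin ler_wpM2l// ler_wsqrtr// lerB// th// leq_add2l.
  exact: ltnW.
rewrite sumEFin lee_fin -mulr_suml -mulr_sumr.
rewrite (_ : \sum_(i < n) (t (a + i).+1 - t (a + i)%N) = t (a + n)%N - t a)//.
elim: n {s} => [|n IH]; first by rewrite big_ord0 addn0 subrr.
by rewrite big_ord_recr/= IH addnS addrC addrA subrK.
Qed.

End BrownianEuler.

(** * A coordinate of the Ornstein-Uhlenbeck process *)

Section Coordinate.
Context {d : measure_display} {T : measurableType d} {R : realType}.
Variable P : probability T R.
Variables (lambda x0 : R) (B X : R -> T -> R).
Hypothesis hB : standard_brownian_motion P B.
Hypothesis l0 : 0 <= lambda.
Hypothesis mX : forall t, 0 <= t -> measurable_fun setT (X t).
Hypothesis cX : {ae P, forall w, continuous_path (X ^~ w)}.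
Hypothesis eqX : {ae P, forall w, forall t, 0 <= t ->
  X t w = x0 + B t w - lambda * \int[lebesgue_measure]_(s in `[0, t]) X s w}.

Lemma measurable_euler_gap (t del : R) N : 0 <= t ->
  measurable [set w | del <= `|X t w - euler lambda x0 (uniform_grid t N) (B ^~ w) N|].
Proof.
move=> t0.
apply: measurable_superlevel; apply: measurableT_comp; first exact: normr_measurable.
apply: measurable_funB; first exact: mX.
apply: (measurable_euler P B hB) => i.
by rewrite -(uniform_grid0 t N) uniform_grid_homo.
Qed.

Lemma euler_cvg_probability (t del : R) : 0 < t -> 0 < del ->
  P [set w | del <= `|X t w - euler lambda x0 (uniform_grid t N) (B ^~ w) N|]%R
    @[N --> \oo] --> 0%E.
Proof.
move=> t0 del0; apply: cvg_probability_ae_eventually.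
  by move=> N; apply: measurable_euler_gap; exact: ltW.
have := sbm_start hB; move: eqX; move: cX.
apply: filterS3 => w cw eqw b0.
have := euler_cvg lambda x0 t (X ^~ w) (B ^~ w) del l0 t0 del0 cw b0 eqw.
by apply: filterS => N; rewrite /= ltNge => /negP.
Qed.

Let U t N a w := euler lambda x0 (uniform_grid t N) (B ^~ w) a.

(** How a bound on the scheme passes to X: the event that the scheme errs by at
    least del has vanishing probability, so only the bound on P (Q N) remains.
    Numbers of steps that are multiples of q + 1 suffice, which lets a grid
    contain a prescribed intermediate time. *)
Lemma probability_euler_limit (t del c : R) (A : set T) (q : nat) (Q : nat -> set T) :
  0 < t -> 0 < del -> measurable A -> (forall N, measurable (Q N)) ->
  (forall N, A `<=` [set w | del <= `|X t w - U t N N w|] `|` Q N) ->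
  (\forall n \near \oo, (P (Q (q.+1 * n.+1)%N) <= c%:E)%E) ->
  (P A <= c%:E)%E.
Proof.
move=> t0 del0 mA mQ AQ Qc; apply/lee_addgt0Pr => e e0.
have := euler_cvg_probability t del t0 del0.
move=> /(_ [set y | (y < e%:E)%E]) /=.
have e_nbhs : nbhs (0%E : \bar R) [set y | (y < e%:E)%E].
  by apply: open_nbhs_nbhs; split; [exact: open_ereal_lt_ereal|rewrite /= lte_fin].
move=> /(_ e_nbhs) [M _ HM]; case: Qc => M' _ HM'.
pose n := maxn M M'; pose N := (q.+1 * n.+1)%N.
have MN : (M <= N)%N.
  by rewrite (leq_trans (leq_maxl M M'))// (leq_trans (leqnSn _))// leq_pmull.
rewrite -EFinD addrC; apply: (probability_cover2 P _ _ (Q N)) (AQ N) _ _ => //.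
- by apply: measurable_euler_gap; exact: ltW.
- exact: ltW (HM N MN).
- by apply: HM'; exact: leq_maxr.
Qed.

(** If |X t| <= del then, outside two exceptional events, |U| <= 2 * del and
    r * U_a plus the last increment is at most 3 * del in absolute value. *)
Lemma small_ball_le (t del h : R) (q : nat) : 0 < t -> 0 < del ->
  h = t / q.+1%:R ->
  (P [set w | `|X t w| <= del]%R <=
    (6 * del / Num.sqrt h + lambda * h * (2 * Num.sqrt h) / del)%:E)%E.
Proof.
move=> t0 del0 hE.
have h0 : 0 < h by rewrite hE divr_gt0.
have mXt := mX _ (ltW t0).
have tgp N i : 0 <= uniform_grid t N i.
  by rewrite -(uniform_grid0 t N) uniform_grid_homo// ltW.
have mU N a := measurable_euler P B hB lambda x0 (uniform_grid t N) a (tgp N).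
apply: (@probability_euler_limit t del _ _ q (fun N => [set w | `|U t N N w| <= 2 * del])) => //.
- by apply: measurable_sublevel; apply: measurableT_comp; [exact: normr_measurable|].
- by move=> N; apply: measurable_sublevel; apply: measurableT_comp; [exact: normr_measurable|exact: mU].
- move=> N w /= Xd; have [|] := leP del `|X t w - U t N N w|; first by left.
  move=> H; right; rewrite (_ : U t N N w = X t w - (X t w - U t N N w)); last by ring.
  by apply: (le_trans (ler_normB _ _)); lra.
(* The grid has (q + 1) * (n + 1) steps, so that the last n + 1 of them cover
   exactly an interval of length h. *)
near=> n; set N := (q.+1 * n.+1)%N; set g := uniform_grid t N.
have N0 : (0 < N)%N by rewrite muln_gt0.
pose a := (q * n.+1)%N.
have aN : (a + n.+1 = N)%N by rewrite /a /N mulSn addnC.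
have gN : g N = t by exact: uniform_grid_end.
have gh : g N - g a = h.
  rewrite /g /uniform_grid hE -mulrBl -natrB -aN ?leq_addr// addKn.
  have n0 : n.+1%:R != 0 :> R by rewrite pnatr_eq0.
  have q0 : q.+1%:R != 0 :> R by rewrite pnatr_eq0.
  rewrite aN /N natrM; move: (n.+1%:R) (q.+1%:R) n0 q0 => x y n0 q0; field.
  by rewrite n0 q0.
have gl k : lambda * (g k.+1 - g k) <= 1.
  rewrite /g uniform_gridS mulrA ler_pdivrMr ?ltr0n// mul1r.
  apply: (@le_trans _ _ n%:R); last by rewrite ler_nat (leq_trans (leqnSn n))// leq_pmull.
  by rewrite ltW//; near: n; exact: nbhs_infty_gtr.
have gth := uniform_grid_homo t N (ltW t0).
pose r := \prod_(i < n.+1) (1 - lambda * (g (a + i).+1 - g (a + i)%N)).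
pose Rem w := \sum_(i < n.+1) lambda * (g (a + i).+1 - g (a + i)%N) *
   `|B (g (a + i)%N) w - B (g a) w|.
have mRem : measurable_fun setT Rem.
  apply: measurable_sum => i; apply: measurable_funM; first exact: measurable_cst.
  apply: measurableT_comp; first exact: normr_measurable.
  by apply: (measurable_increment P B hB); exact: tgp.
have Rem0 w : 0 <= Rem w.
  by apply: sumr_ge0 => i _; rewrite !mulr_ge0// subr_ge0 gth.
apply: (probability_cover2 P _
  [set w | `|r * U t N a w + (B t w - B (g a) w)| <= 3 * del]
  [set w | del <= Rem w]).
- by apply: measurable_sublevel; apply: measurableT_comp; [exact: normr_measurable|exact: mU].
- apply: measurable_sublevel; apply: measurableT_comp; first exact: normr_measurable.
  apply: measurable_funD; last by apply: (measurable_increment P B hB) ; [exact: tgp|exact: ltW].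
  by apply: measurable_funM; [exact: measurable_cst|exact: mU].
- exact: measurable_superlevel.
- move=> w /= Uw; have [|RemD] := leP del (Rem w); [by right|left].
  have := euler_decomposition lambda x0 g (B ^~ w) a n.+1 l0 gth gl.
  rewrite -/r -/(Rem w) aN gN -/(U t N N w) -/(U t N a w) => H.
  set Y := (X in `|X|); rewrite (_ : Y = U t N N w - (U t N N w - Y)); last by ring.
  by apply: (le_trans (ler_normB _ _)); lra.
- have -> : 6 * del = 2 * (3 * del) by ring.
  rewrite -gh gN.
  apply: (euler_anticoncentration P B hB) => //.
  + by rewrite -subr_gt0 -[Y in Y - _]gN gh.
  + lra.
- apply: markov_le => //.
  have := euler_remainder_moment P B hB lambda g a n.+1 l0 (tgp N 0%N) gth.
  by rewrite aN gh.
Unshelve. all: by end_near. Qed.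

(** The decomposition of the scheme from time 0 bounds E |U| by
    |x0| + E |B_t - B_0| + E |Rem|. *)
Lemma large_tail_le (t K : R) : 0 < t -> 0 < K ->
  (P [set w | 2 * K <= `|X t w|]%R <=
    ((`|x0| + (1 + lambda * t) * (2 * Num.sqrt t)) / K)%:E)%E.
Proof.
move=> t0 K0.
have mXt := mX _ (ltW t0).
have tgp N i : 0 <= uniform_grid t N i.
  by rewrite -(uniform_grid0 t N) uniform_grid_homo// ltW.
have mU N a := measurable_euler P B hB lambda x0 (uniform_grid t N) a (tgp N).
apply: (@probability_euler_limit t K _ _ 0 (fun N => [set w | K <= `|U t N N w|])) => //.
- by apply: measurable_superlevel; apply: measurableT_comp; [exact: normr_measurable|].
- by move=> N; apply: measurable_superlevel; apply: measurableT_comp; [exact: normr_measurable|exact: mU].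
- move=> N w /= Xd; have [|] := leP K `|X t w - U t N N w|; first by left.
  move=> H; right; move: Xd.
  rewrite {1}(_ : X t w = (X t w - U t N N w) + U t N N w); last by ring.
  by move=> /le_trans/(_ (ler_normD _ _)); lra.
near=> n; rewrite mul1n; set N := n.+1; set g := uniform_grid t N.
have gN : g N = t by exact: uniform_grid_end.
have g0 : g 0%N = 0 by exact: uniform_grid0.
have gl k : lambda * (g k.+1 - g k) <= 1.
  rewrite /g uniform_gridS mulrA ler_pdivrMr ?ltr0n// mul1r.
  apply: (@le_trans _ _ n%:R); last by rewrite ler_nat leqnSn.
  by rewrite ltW//; near: n; exact: nbhs_infty_gtr.
have gth := uniform_grid_homo t N (ltW t0).
pose r := \prod_(i < N) (1 - lambda * (g (0 + i).+1 - g (0 + i)%N)).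
have r1 : 0 <= r <= 1.
  rewrite prodr_ge0 ?prodr_ile1// => i _.
    rewrite subr_ge0 gl/= gerBl mulr_ge0// subr_ge0; exact: gth.
  by rewrite subr_ge0 gl.
pose Rem w := \sum_(i < N) lambda * (g (0 + i).+1 - g (0 + i)%N) *
   `|B (g (0 + i)%N) w - B (g 0%N) w|.
have mRem : measurable_fun setT Rem.
  apply: measurable_sum => i; apply: measurable_funM; first exact: measurable_cst.
  apply: measurableT_comp; first exact: normr_measurable.
  by apply: (measurable_increment P B hB); exact: tgp.
have Rem0 w : 0 <= Rem w.
  by apply: sumr_ge0 => i _; rewrite !mulr_ge0// subr_ge0 gth.
apply: markov_le => //.
  by apply: measurableT_comp; [exact: normr_measurable|exact: mU].
have mI : measurable_fun setT (fun w => `|B t w - B 0 w|).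
  apply: measurableT_comp; first exact: normr_measurable.
  by apply: (measurable_increment P B hB) => //; exact: ltW.
apply: (@le_trans _ _ (\int[P]_w (`|x0|%:E + (`|B t w - B 0 w|%:E + (Rem w)%:E)))%E).
  apply: ge0_le_integral => //=.
  - apply/measurable_EFinP; apply: measurableT_comp; [exact: normr_measurable|exact: mU].
  - by apply: emeasurable_funD; [exact: measurable_cst|apply: emeasurable_funD; exact/measurable_EFinP].
  move=> w _; rewrite -!EFinD lee_fin.
  have := euler_decomposition lambda x0 g (B ^~ w) 0 N l0 gth gl.
  rewrite -/r -/(Rem w) add0n gN g0 -/(U t N N w) /= => H.
  rewrite (_ : U t N N w = r * x0 + ((B t w - B 0 w) + (U t N N w - (r * x0 + (B t w - B 0 w))))); last by ring.
  apply: (le_trans (ler_normD _ _)); rewrite lerD//.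
    by rewrite normrM ler_piMl// ger0_norm; case/andP: r1.
  by apply: (le_trans (ler_normD _ _)); rewrite lerD.
rewrite ge0_integralD//; last 2 first.
- by move=> w _; rewrite -EFinD lee_fin addr_ge0.
- by apply: emeasurable_funD; exact/measurable_EFinP.
rewrite integral_cst//= probability_setT mule1 EFinD leeD2l//.
rewrite ge0_integralD//; try exact/measurable_EFinP; last first.
  by move=> w _; rewrite lee_fin.
rewrite mulrDl mul1r EFinD leeD//.
  have := increment_abs_moment P B hB 0 t (lexx 0) (ltW t0).
  by rewrite subr0.
apply: (le_trans (euler_remainder_moment P B hB lambda g 0 N l0 (tgp N 0%N) gth)).
by rewrite add0n gN g0 !subr0.
Unshelve. all: by end_near. Qed.

Lemma probability_exp_small (e eta : R) : 0 < e -> 0 < eta ->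
  \forall t \near +oo, (P [set w | `|X t w| <= expR (- (e * t))]%R <= eta%:E)%E.
Proof.
move=> e0 eta0.
pose C := 12 + 2 * lambda; have C0 : 0 < C by rewrite /C; have := l0; lra.
pose c := (eta / C) ^+ 2; have c0 : 0 < c by rewrite exprn_gt0// divr_gt0.
near=> t.
have t1 : 1 <= t by near: t; apply: nbhs_pinfty_ge; exact: num_real.
have t0 : 0 < t by exact: lt_le_trans t1.
have et0 : 0 < e * t by rewrite mulr_gt0.
set del := expR _; have del0 : 0 < del by exact: expR_gt0.
have delc : del <= c.
  rewrite /del expRN -[leRHS]invrK lef_pV2 ?posrE ?expR_gt0 ?invr_gt0//.
  apply: le_trans (expR_ge1Dx _); rewrite ler_wpDl//.
  rewrite mulrC -ler_pdivrMr; last by [].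
  by near: t; apply: nbhs_pinfty_ge; exact: num_real.
have del1 : del <= 1 by rewrite /del -expR0 ler_expR oppr_le0 ltW.
(* h = t / (q + 1) satisfies del / 2 <= h <= del. *)
pose q := Num.truncn (t / del).
have td0 : 0 <= t / del by rewrite divr_ge0// ltW.
have /andP[qle qlt] : q%:R <= t / del < q.+1%:R by apply: truncn_itv.
pose h := t / q.+1%:R.
have h0 : 0 < h by rewrite divr_gt0.
have hdel : h <= del.
  by rewrite /h ler_pdivrMr// mulrC -ler_pdivrMr// ltW.
have delh : del <= 2 * h.
  rewrite /h mulrA ler_pdivlMr// -natr1 mulrDr mulr1.
  have : del * q%:R <= t by rewrite mulrC -ler_pdivlMr.
  lra.
have := small_ball_le t del h q t0 del0 erefl.
move=> /le_trans; apply; rewrite lee_fin.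
have sh0 : 0 < Num.sqrt h by rewrite sqrtr_gt0.
have hE : h = Num.sqrt h * Num.sqrt h by rewrite -expr2 sqr_sqrtr// ltW.
have shc : Num.sqrt h <= eta / C.
  rewrite -[leRHS]gtr0_norm ?divr_gt0// -[leRHS]sqrtr_sqr ler_wsqrtr//.
  exact: le_trans hdel delc.
apply: (@le_trans _ _ (C * Num.sqrt h)); last by rewrite mulrC -ler_pdivlMr.
rewrite /C [leRHS]mulrDl; apply: lerD.
  by rewrite ler_pdivrMr// -mulrA -hE; lra.
rewrite ler_pdivrMr// (_ : lambda * h * (2 * Num.sqrt h) = 2 * lambda * Num.sqrt h * h); last by ring.
by rewrite ler_wpM2l// !mulr_ge0// ltW.
Unshelve. all: by end_near. Qed.

Lemma probability_exp_large (e eta : R) : 0 < e -> 0 < eta ->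
  \forall t \near +oo, (P [set w | expR (e * t) / 2 <= `|X t w|]%R <= eta%:E)%E.
Proof.
move=> e0 eta0.
pose C := `|x0| + 2 + 2 * lambda.
have C0 : 0 < C by rewrite /C; have := normr_ge0 x0; have := l0; lra.
near=> t.
have t1 : 1 <= t by near: t; apply: nbhs_pinfty_ge; exact: num_real.
have t0 : 0 < t by exact: lt_le_trans t1.
pose K := expR (e * t) / 4.
have K0 : 0 < K by rewrite divr_gt0// expR_gt0.
rewrite (_ : expR (e * t) / 2 = 2 * K); last by rewrite /K; field.
have := large_tail_le t K t0 K0.
move=> /le_trans; apply; rewrite lee_fin ler_pdivrMr//.
have st : Num.sqrt t <= t.
  rewrite -[leRHS]gtr0_norm// -[leRHS]sqrtr_sqr ler_wsqrtr//.
  by rewrite expr2 ler_peMl// ltW.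
have tt : t <= t * t by rewrite ler_peMl// ltW.
apply: (@le_trans _ _ (C * (t * t))).
  rewrite /C; have nx := normr_ge0 x0.
  have -> : (`|x0| + 2 + 2 * lambda) * (t * t) =
     `|x0| * (t * t) + (t * t + lambda * t * t) * 2 by ring.
  apply: lerD; first by rewrite ler_peMr// (le_trans t1).
  apply: (@le_trans _ _ ((1 + lambda * t) * (2 * t))).
    by rewrite ler_wpM2l ?addr_ge0 ?mulr_ge0// ?(ltW t0)// ler_wpM2l.
  have -> : (1 + lambda * t) * (2 * t) = (t + lambda * t * t) * 2 by ring.
  by rewrite ler_wpM2r// lerD2r.
(* A cubic lower bound of the exponential beats the quadratic numerator. *)
have e3 : (e * t / 3) ^+ 3 <= expR (e * t).
  rewrite (_ : expR (e * t) = expR (e * t / 3) ^+ 3); last first.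
    by rewrite -expRM_natr; congr expR; rewrite divfK.
  rewrite ler_pXn2r ?nnegrE ?expR_ge0 ?divr_ge0 ?mulr_ge0 ?(ltW e0) ?(ltW t0)//.
  by apply: le_trans (expR_ge1Dx _); rewrite lerDr.
have tbig : 108 * C / (e ^+ 3 * eta) <= t by near: t; apply: nbhs_pinfty_ge; exact: num_real.
have e30 : 0 < e ^+ 3 * eta by rewrite mulr_gt0// exprn_gt0.
rewrite /K; apply: (@le_trans _ _ (eta * ((e * t / 3) ^+ 3 / 4))); last first.
  by rewrite ler_wpM2l// ?(ltW eta0)// ler_wpM2r.
move: tbig; rewrite ler_pdivrMr// => tbig.
have -> : eta * ((e * t / 3) ^+ 3 / 4) = (t * (e ^+ 3 * eta)) / 108 * (t * t) by field.
rewrite ler_wpM2r ?mulr_ge0 ?(ltW t0)//.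
by rewrite ler_pdivlMr// mulrC.
Unshelve. all: by end_near. Qed.

End Coordinate.

(** * The radial process *)

Local Open Scope complex_scope.

Theorem theorem3p4 (R : realType) (d : measure_display)
    (T : measurableType d) (P : probability T R) (lambda : R)
    (W Z : R -> T -> R[i]) :
  0 <= lambda ->
  planar_brownian_motion P W ->
  ornstein_uhlenbeck P lambda (1 +i* 0) W Z ->
  converges_in_law P (fun t w => ln (radial_process Z t w) / t) \d_(0 : R).
Proof.
move=> l0 [hre him _] [mre mim cre cim eqZ].
have eqre : {ae P, forall w, forall t, 0 <= t ->
    re_process Z t w = 1 + re_process W t w -
      lambda * \int[lebesgue_measure]_(s in `[0, t]) re_process Z s w}.
  apply: filterS eqZ => w Hw t t0.
  rewrite /re_process (Hw t t0) /complex_integral.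
  by case: (W t w) => a b /=; rewrite mul0r subr0.
have eqim : {ae P, forall w, forall t, 0 <= t ->
    im_process Z t w = 0 + im_process W t w -
      lambda * \int[lebesgue_measure]_(s in `[0, t]) im_process Z s w}.
  apply: filterS eqZ => w Hw t t0.
  rewrite /im_process (Hw t t0) /complex_integral.
  by case: (W t w) => a b /=; rewrite mul0r addr0.
have radE t w : radial_process Z t w =
    Num.sqrt (re_process Z t w ^+ 2 + im_process Z t w ^+ 2).
  by rewrite /radial_process /re_process /im_process; case: (Z t w).
have mR t : 0 <= t -> measurable_fun setT (radial_process Z t).
  move=> t0; rewrite (_ : radial_process Z t =
    Num.sqrt \o (fun w => re_process Z t w ^+ 2 + im_process Z t w ^+ 2)); last first.
    by apply/funext => w; rewrite radE.
  apply: measurableT_comp.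
    by apply: continuous_measurable_fun; exact: sqrt_continuous.
  by apply: measurable_funD; apply: measurable_funX; [exact: mre|exact: mim].
have mL t : 0 <= t -> measurable_fun setT (fun w => ln (radial_process Z t w) / t).
  move=> t0; apply: measurable_funM; last exact: measurable_cst.
  by apply: measurableT_comp; [exact: measurable_ln|exact: mR].
apply: cvg_probability_law0.
  by near=> t; apply: mL.
move=> e eta e0 eta0.
have eta3 : 0 < eta / 3 by rewrite divr_gt0.
near=> t.
have t0 : 0 < t by near: t; apply: nbhs_pinfty_gt; exact: num_real.
have Psmall : (P [set w | `|re_process Z t w| <= expR (- (e * t))]%R <= (eta / 3)%:E)%E.
  by near: t; exact: probability_exp_small hre l0 mre cre eqre _ _ e0 eta3.
have Pre : (P [set w | expR (e * t) / 2 <= `|re_process Z t w|]%R <= (eta / 3)%:E)%E.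
  by near: t; exact: probability_exp_large hre l0 mre cre eqre _ _ e0 eta3.
have Pim : (P [set w | expR (e * t) / 2 <= `|im_process Z t w|]%R <= (eta / 3)%:E)%E.
  by near: t; exact: probability_exp_large him l0 mim cim eqim _ _ e0 eta3.
have mN (f : T -> R) : measurable_fun setT f -> measurable_fun setT (fun w => `|f w|).
  by move=> mf; apply: measurableT_comp; [exact: normr_measurable|].
have mA := measurable_superlevel _ e (mN _ (mL _ (ltW t0))).
have m1 := measurable_sublevel _ (expR (- (e * t))) (mN _ (mre _ (ltW t0))).
have m2 := measurable_superlevel _ (expR (e * t) / 2) (mN _ (mre _ (ltW t0))).
have m3 := measurable_superlevel _ (expR (e * t) / 2) (mN _ (mim _ (ltW t0))).
have -> : eta = eta / 3 + (eta / 3 + eta / 3) by field.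
have m23 := measurableU _ _ m2 m3.
apply: (probability_cover2 P _ _ _ _ _ mA m1 m23) => //; last first.
  by apply: (probability_cover2 P _ _ _ _ _ m23 m2 m3).
move=> w /=; rewrite normrM normfV (gtr0_norm t0) ler_pdivlMr//.
rewrite radE; set x := re_process Z t w; set y := im_process Z t w.
set r := Num.sqrt _ => rbig.
have et0 : 0 < e * t by rewrite mulr_gt0.
(* ln 0 is 0 by convention, which is incompatible with rbig. *)
have r0 : 0 < r.
  rewrite lt0r sqrtr_ge0 andbT; apply/negP => /eqP r0.
  by move: rbig; rewrite r0 ln0// normr0 leNgt et0.
have xr : `|x| <= r.
  by rewrite -[leLHS]sqrtr_sqr ler_wsqrtr// lerDl sqr_ge0.
have rxy : r <= `|x| + `|y|.
  rewrite -[leRHS]ger0_norm ?addr_ge0// -[leRHS]sqrtr_sqr ler_wsqrtr//.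
  rewrite sqrrD !real_normK ?num_real// -addrA lerD2l lerDr mulrn_wge0//.
move: rbig; rewrite ler_normr => /orP[rbig|rsmall].
  have : expR (e * t) <= r by rewrite -[leRHS]lnK ?posrE// ler_expR.
  have [xbig|xs] := leP (expR (e * t) / 2) `|x|; first by right; left.
  have [ybig|ys] := leP (expR (e * t) / 2) `|y|; first by right; right.
  lra.
left; apply: (le_trans xr); rewrite -[leLHS]lnK ?posrE// ler_expR.
by rewrite lerNr.
Unshelve. all: by end_near. Qed.
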